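(* For every integer $n\ge1$, the category $\mathfrak{e}_n$, whose objects are the elementary $\mathrm{Cu}$-semigroups $E_{n^k}$ with $k\in\mathbb{N}$ and whose morphisms are all the order-embeddings $E_{n^k}\to E_{n^s}$ given by multiplication by a power of $n$, is a (Cuntz) Fraïssé category.
   Context: **$\mathrm{Cu}$-semigroups.** For $x,y$ in a partially ordered set, $x\ll y$ means: for every increasing sequence $(z_n)_n$ having a supremum with $y\le\sup_n z_n$, there is $n$ with $x\le z_n$. A $\mathrm{Cu}$-semigroup is a positively ordered (commutative) monoid $S$ such that (O1) every increasing sequence has a supremum; (O2) every element is the supremum of a $\ll$-increasing sequence; (O3) $x'\ll x$ and $y'\ll y$ imply $x'+y'\ll x+y$; (O4) $\sup_n(x_n+y_n)=\sup_n x_n+\sup_n y_n$ for increasing sequences. A $\mathrm{Cu}$-morphism is a monoid morphism preserving the order, the relation $\ll$, and suprema of increasing sequences. $\mathrm{Cu}$ denotes the resulting category. An order-embedding between $\mathrm{Cu}$-semigroups always means a $\mathrm{Cu}$-morphism $\alpha$ such that $\alpha(x)\le\alpha(y)$ implies $x\le y$. $S$ is countably-based if there is a countable subset $B\subseteq S$ such that every element of $S$ is the supremum of a $\ll$-increasing sequence in $B$. **The semigroups $E_m$.** For $m\ge1$, $E_m=\{0,1,\ldots,m,\infty\}$ with its natural total order and with addition as in $\mathbb{N}$, except that $x+y=\infty$ whenever the sum exceeds $m$ or one of the summands is $\infty$. ''Multiplication by $n^j$'' is the map $E_{n^k}\to E_{n^s}$ sending $x\in\{0,\ldots,n^k\}$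 to the $n^jx$-fold sum of $1\in E_{n^s}$, and $\infty$ to $\infty$ ($j\in\mathbb{N}$); only those maps of this form that are order-embeddings (in particular $\mathrm{Cu}$-morphisms) are morphisms of $\mathfrak{e}_n$. **Finite-set comparison.** For $\mathrm{Cu}$-morphisms $\alpha,\beta\colon S\to T$ and a finite set $F\subseteq S$, write $\alpha\simeq_F\beta$ if $\alpha(x')\le\beta(x)$ and $\beta(x')\le\alpha(x)$ for all $x',x\in F$ with $x'\ll x$. **Fraïssé categories.** A subcategory $\mathfrak{c}$ of $\mathrm{Cu}$ is a (Cuntz) Fraïssé category if: - (JEP) for any $A_1,A_2\in\mathfrak{c}$ there is $B\in\mathfrak{c}$ with $\mathrm{Hom}_{\mathfrak{c}}(A_1,B)$ and $\mathrm{Hom}_{\mathfrak{c}}(A_2,B)$ nonempty; - (NAP) for any $\mathfrak{c}$-morphisms $\alpha_1\colon A\to B_1$, $\alpha_2\colon A\to B_2$ and any finite $F\subseteq A$, there are $C\in\mathfrak{c}$ and $\mathfrak{c}$-morphisms $\beta_1\colon B_1\to C$, $\beta_2\colon B_2\to C$ with $\beta_1\circ\alpha_1\simeq_F\beta_2\circ\alpha_2$; - (SEP) there is a subcategory $\mathfrak{s}\subseteq\mathfrak{c}$ whose objects are countably-based, whose set of morphisms is countable, such that every $A\in\mathfrak{c}$ admits a $\mathfrak{c}$-morphism to some $S\in\mathfrak{s}$, and such that for any $\mathfrak{c}$-morphism $\sigma\colon S\to A$ with $S\in\mathfrak{s}$ and any finite $F\subseteq S$ there are $T\in\mathfrak{s}$,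 $\alpha\in\mathrm{Hom}_{\mathfrak{c}}(A,T)$, $\tau\in\mathrm{Hom}_{\mathfrak{s}}(S,T)$ with $\alpha\circ\sigma\simeq_F\tau$. *)

(* Defs.v *)
From HB Require Import structures.
From mathcomp Require Import all_boot all_order all_algebra zify.
From mathcomp Require Import boolp classical_sets cardinality.

Set Implicit Arguments.
Unset Strict Implicit.
Unset Printing Implicit Defensive.

Import Order.TTheory GRing.Theory Num.Theory.
Local Open Scope classical_set_scope.
Local Open Scope ring_scope.

Record pomType := POMonoid {
  pom_nmod :> nmodType;
  pom_le : pom_nmod -> pom_nmod -> Prop;
  pom_le_refl : forall x, pom_le x x;
  pom_le_anti : forall x y, pom_le x y -> pom_le y x -> x = y;
  pom_le_trans : forall x y z, pom_le x y -> pom_le y z -> pom_le x z;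
  pom_ge0 : forall x, pom_le 0 x;
  pom_leD2r : forall z x y, pom_le x y -> pom_le (x + z) (y + z)
}.

Notation "x `<= y" := (pom_le x y) (at level 70, no associativity).

(* As usual for Cu-semigroups, "increasing" is not strict. *)
Definition increasing {T : pomType} (u : nat -> T) : Prop :=
  forall i j : nat, (i <= j)%N -> u i `<= u j.

Definition is_sup {T : pomType} (u : nat -> T) (s : T) : Prop :=
  (forall n, u n `<= s) /\ forall t, (forall n, u n `<= t) -> s `<= t.

Definition way_below {T : pomType} (x y : T) : Prop :=
  forall (z : nat -> T) (s : T),
    increasing z -> is_sup z s -> y `<= s -> exists n, x `<= z n.

Notation "x `<< y" := (way_below x y) (at level 70, no associativity).

Definition ll_increasing {T : pomType} (u : nat -> T) : Prop :=
  forall n, u n `<< u n.+1.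

Record cuType := CuSemigroup {
  cu_pom :> pomType;
  cu_O1 : forall u : nat -> cu_pom, increasing u -> exists s, is_sup u s;
  cu_O2 : forall x : cu_pom,
    exists2 u : nat -> cu_pom, ll_increasing u & is_sup u x;
  cu_O3 : forall x' x y' y : cu_pom,
    x' `<< x -> y' `<< y -> x' + y' `<< x + y;
  cu_O4 : forall (u v : nat -> cu_pom) (s t : cu_pom),
    increasing u -> increasing v -> is_sup u s -> is_sup v t ->
    is_sup (fun n => u n + v n) (s + t)
}.

Definition countably_based (S : cuType) : Prop :=
  exists2 B : set S, countable B &
    forall x : S, exists u : nat -> S,
      [/\ forall n, B (u n), ll_increasing u & is_sup u x].

Record cuMor (S T : cuType) := CuMor {
  cu_fun :> {additive S -> T};
  cu_mono : forall x y : S, x `<= y -> cu_fun x `<= cu_fun y;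
  cu_ll : forall x y : S, x `<< y -> cu_fun x `<< cu_fun y;
  cu_sup : forall (u : nat -> S) (s : S),
    increasing u -> is_sup u s -> is_sup (cu_fun \o u) (cu_fun s)
}.

Definition order_embedding {S T : cuType} (f : cuMor S T) : Prop :=
  forall x y : S, f x `<= f y -> x `<= y.

Definition cu_id (S : cuType) : cuMor S S.
Proof. by exists (idfun : {additive S -> S}). Defined.

Definition cu_comp {S T U : cuType} (g : cuMor T U) (f : cuMor S T) :
  cuMor S U.
Proof.
exists ((g \o f) : {additive S -> U}).
- by move=> x y /cu_mono/cu_mono; apply.
- by move=> x y /cu_ll/cu_ll; apply.
- move=> u s iu su; apply: (@cu_sup _ _ g (f \o u)); last exact: cu_sup.
  by move=> i j /iu; apply: cu_mono.
Defined.

Definition sim_on {S T : cuType} (F : set S) (f g : cuMor S T) : Prop :=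
  forall x' x : S, F x' -> F x -> x' `<< x -> f x' `<= g x /\ g x' `<= f x.

(* Subcategories of Cu, not necessarily full. *)
Record subcategory := Subcategory {
  obj : cuType -> Prop;
  hom : forall A B : cuType, cuMor A B -> Prop;
  hom_obj : forall (A B : cuType) (f : cuMor A B), hom f -> obj A /\ obj B;
  hom_id : forall A : cuType, obj A -> hom (cu_id A);
  hom_comp : forall (A B C : cuType) (f : cuMor A B) (g : cuMor B C),
    hom f -> hom g -> hom (cu_comp g f)
}.

Arguments hom c {A B} : rename.

Definition subcategory_le (s c : subcategory) : Prop :=
  (forall A : cuType, obj s A -> obj c A) /\
  (forall (A B : cuType) (f : cuMor A B), hom s f -> hom c f).

(* The library predicate countable does not apply to a class of arrows of Cu,
   for universe reasons; this is the same notion, an injection into nat. *)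
Definition countable_arrows (c : subcategory) : Prop :=
  exists e : {A : cuType & {B : cuType & cuMor A B}} -> nat,
  forall (A B A' B' : cuType) (f : cuMor A B) (g : cuMor A' B'),
    hom c f -> hom c g ->
    let pf := existT _ A (existT _ B f) in
    let pg := existT _ A' (existT _ B' g) in
    e pf = e pg -> pf = pg.

Definition JEP (c : subcategory) : Prop :=
  forall A1 A2 : cuType, obj c A1 -> obj c A2 ->
  exists B : cuType, [/\ obj c B,
    exists f : cuMor A1 B, hom c f & exists f : cuMor A2 B, hom c f].

Definition NAP (c : subcategory) : Prop :=
  forall (A B1 B2 : cuType) (a1 : cuMor A B1) (a2 : cuMor A B2) (F : set A),
  hom c a1 -> hom c a2 -> finite_set F ->
  exists (C : cuType) (b1 : cuMor B1 C) (b2 : cuMor B2 C),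
    [/\ obj c C, hom c b1, hom c b2 &
        sim_on F (cu_comp b1 a1) (cu_comp b2 a2)].

Definition SEP (c : subcategory) : Prop :=
  exists s : subcategory,
  [/\ subcategory_le s c,
      forall S : cuType, obj s S -> countably_based S,
      countable_arrows s,
      forall A : cuType, obj c A ->
        exists (S : cuType) (f : cuMor A S), obj s S /\ hom c f
    & forall (S A : cuType) (sigma : cuMor S A) (F : set S),
        obj s S -> hom c sigma -> finite_set F ->
        exists (T : cuType) (alpha : cuMor A T) (tau : cuMor S T),
          [/\ obj s T, hom c alpha, hom s tau &
              sim_on F (cu_comp alpha sigma) tau]].

Definition fraisse_category (c : subcategory) : Prop :=
  [/\ JEP c, NAP c & SEP c].

(* The carrier {0, ..., m, oo} of E_m, with None standing for oo. *)
Definition elem (m : nat) : Type := option 'I_m.+1.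

Section Elementary.
Variable m : nat.
Implicit Types x y z : elem m.

Definition elem_le x y : bool :=
  match x, y with
  | _, None => true
  | None, Some _ => false
  | Some i, Some j => (i <= j)%N
  end.

(* insub k : option 'I_m.+1 is k if k <= m, and None, i.e. oo, otherwise. *)
Definition elem_add x y : elem m :=
  match x, y with
  | Some i, Some j => insub (i + j)%N
  | _, _ => None
  end.

Definition elem_rank x : nat := if x is Some i then i else m.+1.

Lemma elem_rank_inj : injective elem_rank.
Proof.
move=> [i|] [j|] //= e; first by congr Some; apply: val_inj.
- by have := ltn_ord i; rewrite e ltnn.
- by have := ltn_ord j; rewrite -e ltnn.
Qed.

Lemma elem_rank_le x : (elem_rank x <= m.+1)%N.
Proof. by case: x => [i|] //=; apply: ltnW. Qed.

Lemma elem_leE x y : elem_le x y = (elem_rank x <= elem_rank y)%N.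
Proof.
case: x y => [i|] [j|] //=; last by rewrite leqnn.
- by rewrite ltnW.
- by rewrite leqNgt ltn_ord.
Qed.

Lemma elem_rankD x y :
  elem_rank (elem_add x y) = minn (elem_rank x + elem_rank y) m.+1.
Proof.
case: x y => [i|] [j|] /=; last 3 first.
- by rewrite (minn_idPr _) ?leq_addl.
- by rewrite (minn_idPr _) ?leq_addr.
- by rewrite (minn_idPr _) ?leq_addr.
case: insubP => [k _ /= <-|] /=; last first.
  by rewrite -leqNgt => /minn_idPr.
by rewrite (minn_idPl _) 1?ltnW.
Qed.

Lemma elem_addA : associative elem_add.
Proof. by move=> x y z; apply: elem_rank_inj; rewrite !elem_rankD; lia. Qed.

Lemma elem_addC : commutative elem_add.
Proof. by move=> x y; apply: elem_rank_inj; rewrite !elem_rankD addnC. Qed.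

Lemma elem_add0 : left_id (Some ord0) elem_add.
Proof.
move=> x; apply: elem_rank_inj; rewrite !elem_rankD /=.
by have := elem_rank_le x; lia.
Qed.

Lemma elem_le_refl : reflexive elem_le.
Proof. by move=> x; rewrite elem_leE. Qed.

Lemma elem_le_anti x y : elem_le x y -> elem_le y x -> x = y.
Proof. by rewrite !elem_leE => xy yx; apply/elem_rank_inj/eqP; rewrite eqn_leq xy. Qed.

Lemma elem_le_trans x y z : elem_le x y -> elem_le y z -> elem_le x z.
Proof. by rewrite !elem_leE; apply: leq_trans. Qed.

HB.instance Definition _ := Choice.on (elem m).
HB.instance Definition _ :=
  GRing.isNmodule.Build (elem m) elem_addA elem_addC elem_add0.

Lemma elem_ge0 x : elem_le 0 x.
Proof. by rewrite elem_leE. Qed.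

Lemma elem_leD2r z x y : elem_le x y -> elem_le (x + z) (y + z).
Proof. by rewrite !elem_leE ![elem_rank (_ + _)]elem_rankD; lia. Qed.

Definition elem_pom : pomType :=
  POMonoid elem_le_refl elem_le_anti elem_le_trans elem_ge0 elem_leD2r.

Lemma elem_seq_max (u : nat -> elem_pom) : exists N, forall n, u n `<= u N.
Proof.
pose P k := `[< exists n, elem_rank (u n) = k >].
have exP : exists k, P k by exists (elem_rank (u 0%N)); apply/asboolP; exists 0%N.
have bP k : P k -> (k <= m.+1)%N.
  by move=> /asboolP[n <-]; apply: elem_rank_le.
case: (ex_maxnP exP bP) => k /asboolP[N eN] maxk.
exists N => n; rewrite /= elem_leE eN; apply: maxk.
by apply/asboolP; exists n.
Qed.

Lemma elem_supP (u : nat -> elem_pom) N :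
  (forall n, u n `<= u N) -> is_sup u (u N).
Proof. by move=> uN; split=> // t; apply. Qed.

Lemma elem_sup_max (u : nat -> elem_pom) s :
  is_sup u s -> exists2 N, s = u N & forall n, u n `<= u N.
Proof.
case=> us sl; have [N uN] := elem_seq_max u; exists N => //.
by apply: (@pom_le_anti elem_pom); [apply: sl|apply: us].
Qed.

Lemma elem_llE (x y : elem_pom) : x `<< y <-> x `<= y.
Proof.
split=> [xy|xy z s _ /elem_sup_max[N -> _] ys]; last first.
  by exists N; apply: pom_le_trans ys.
have [||] // := xy (fun=> y) y _ _ (pom_le_refl y).
  by move=> i j _; apply: pom_le_refl.
apply: (@elem_supP (fun=> y) 0%N) => n; exact: pom_le_refl.
Qed.

Lemma elem_leD (x' x y' y : elem_pom) :
  x' `<= x -> y' `<= y -> x' + y' `<= x + y.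
Proof.
move=> xx yy; apply: pom_le_trans (pom_leD2r y' xx) _.
by rewrite ![x + _]addrC; apply: pom_leD2r.
Qed.

Lemma elem_O1 (u : nat -> elem_pom) : increasing u -> exists s, is_sup u s.
Proof. by have [N /elem_supP] := elem_seq_max u; exists (u N). Qed.

Lemma elem_O2 (x : elem_pom) :
  exists2 u : nat -> elem_pom, ll_increasing u & is_sup u x.
Proof.
exists (fun=> x); first by move=> n; apply/elem_llE; apply: pom_le_refl.
by apply: (@elem_supP (fun=> x) 0%N) => n; apply: pom_le_refl.
Qed.

Lemma elem_O3 (x' x y' y : elem_pom) :
  x' `<< x -> y' `<< y -> x' + y' `<< x + y.
Proof. by rewrite !elem_llE; apply: elem_leD. Qed.

Lemma elem_O4 (u v : nat -> elem_pom) (s t : elem_pom) :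
  increasing u -> increasing v -> is_sup u s -> is_sup v t ->
  is_sup (fun n => u n + v n) (s + t).
Proof.
move=> iu iv /elem_sup_max[N -> uN] /elem_sup_max[M -> vM].
have -> : u N = u (maxn N M).
  by apply: (@pom_le_anti elem_pom) (uN _); apply: iu; rewrite leq_maxl.
have -> : v M = v (maxn N M).
  by apply: (@pom_le_anti elem_pom) (vM _); apply: iv; rewrite leq_maxr.
apply: (@elem_supP (fun n => u n + v n)) => n; apply: elem_leD.
  by apply: pom_le_trans (uN n) _; apply: iu; rewrite leq_maxl.
by apply: pom_le_trans (vM n) _; apply: iv; rewrite leq_maxr.
Qed.

Definition E : cuType := CuSemigroup elem_O1 elem_O2 elem_O3 elem_O4.

End Elementary.

Definition elem_oo (m : nat) : elem m := None.

(* The element 1 of E_m when 1 <= m. *)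
Definition elem_one (m : nat) : elem m := Some (inord 1).

Definition is_mul_by {m m' : nat} (a : nat) (f : cuMor (E m) (E m')) : Prop :=
  (forall x : 'I_m.+1, f (Some x) = elem_one m' *+ (a * x)%N) /\
  f (elem_oo m) = elem_oo m'.

Inductive e_obj (n : nat) : cuType -> Prop :=
| EObj (k : nat) : e_obj n (E (n ^ k)%N).

Inductive e_hom (n : nat) : forall A B : cuType, cuMor A B -> Prop :=
| EHom (k s j : nat) (f : cuMor (E (n ^ k)%N) (E (n ^ s)%N)) :
    is_mul_by (n ^ j)%N f -> order_embedding f -> e_hom n f.

Lemma E_inj m m' : E m = E m' -> m = m'.
Proof.
move=> e.
have [f /bij_eq_card] : exists f : E m -> E m', bijective f.
  by rewrite e; exists id; exists id.
by rewrite !card_option !card_ord => -[].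
Qed.

Lemma e_hom_obj n (A B : cuType) (f : cuMor A B) :
  e_hom n f -> e_obj n A /\ e_obj n B.
Proof. by case=> *; split; constructor. Qed.

Lemma elem_rankMn m (k : nat) : (0 < m)%N ->
  elem_rank (elem_one m *+ k) = minn k m.+1.
Proof.
move=> m0; elim: k => [|k IHk]; first by rewrite mulr0n min0n.
rewrite mulrS [LHS]elem_rankD IHk /= inordK; lia.
Qed.

Lemma elem_one_Mn m (x : 'I_m.+1) : elem_one m *+ x = Some x.
Proof.
case: m x => [|m] x; first by rewrite ord1 mulr0n.
apply: elem_rank_inj; rewrite elem_rankMn //=; have := ltn_ord x; lia.
Qed.

Lemma e_hom_id n (A : cuType) : e_obj n A -> e_hom n (cu_id A).
Proof.
case=> k; apply: (@EHom n k k 0) => //; split=> // x.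
by rewrite expn0 mul1n elem_one_Mn.
Qed.

Lemma is_mul_by_comp m1 m2 m3 a b
    (f : cuMor (E m1) (E m2)) (g : cuMor (E m2) (E m3)) :
  order_embedding f -> is_mul_by a f -> is_mul_by b g ->
  is_mul_by (b * a)%N (cu_comp g f).
Proof.
move=> of_ [fS foo] [gS goo]; split; last by rewrite /= foo goo.
move=> x; rewrite /= fS.
case: (posnP m2) => [m20|m2_gt0].
  have fx0 : f (Some x) = f 0.
    rewrite fS raddf0; elim: (a * x)%N => [|k IHk]; rewrite ?mulr0n //.
    rewrite mulrS IHk addr0 /elem_one; congr Some; apply: val_inj => /=.
    have := ltn_ord (inord 1 : 'I_m2.+1).
    by move: (nat_of_ord _) => v; rewrite m20; case: v.
  have /eqP : Some x = 0 :> elem m1.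
    by apply: elem_le_anti; apply: of_; rewrite fx0; apply: pom_le_refl.
  by move=> /eqP[->]; rewrite !muln0 !mulr0n raddf0.
by rewrite raddfMn gS /= inordK // muln1 -mulrnA mulnA.
Qed.

Lemma e_hom_comp n (A B C : cuType) (f : cuMor A B) (g : cuMor B C) :
  e_hom n f -> e_hom n g -> e_hom n (cu_comp g f).
Proof.
move=> hf; case: hf g => k s j {}f fM fE g.
have aux (B' : cuType) (g' : cuMor B' C) : e_hom n g' ->
    forall e : B' = E (n ^ s)%N,
    e_hom n (cu_comp (eq_rect B' (fun X => cuMor X C) g' _ e) f).
  case=> k' s' j' {}g' gM gE e.
  have ek := E_inj e.
  move: f fM fE e; rewrite -ek => f fM fE e.
  rewrite (Prop_irrelevance e erefl) /=.
  apply: (@EHom n k s' (j' + j)); first by rewrite expnD; apply: is_mul_by_comp.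
  by move=> x y /gE/fE.
by move=> hg; apply: (aux _ g hg erefl).
Qed.

Definition e_cat (n : nat) : subcategory :=
  Subcategory (@e_hom_obj n) (@e_hom_id n) (@e_hom_comp n).

(* Main.v *)
Require Import Defs.
From mathcomp Require Import all_boot.
From HB Require Import structures.
From mathcomp Require Import all_algebra zify.
From mathcomp Require Import boolp classical_sets cardinality.

(** A morphism [E_(n^k) -> E_(n^s)] of [e_n] is multiplication by the unique
    number [a] with [a * n^k = n^s]: the order-embedding condition at [n^k] and
    [oo] gives [a * n^k <= n^s], additivity at [n^k + 1 = oo] gives
    [n^s < a * (n^k + 1)], and all three numbers are powers of [n].  Hence there
    is exactly one morphism when [k <= s], every diagram in [e_n] commutes, and
    [e_n] serves as its own countable dominating subcategory. *)

Set Implicit Arguments.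
Unset Strict Implicit.
Unset Printing Implicit Defensive.

Import GRing.Theory.

(** Test [<<] against the constant sequence at [y]. *)
Lemma way_below_le (T : pomType) (x y : T) : x `<< y -> x `<= y.
Proof.
move=> xy; have [|||k //] := xy (fun=> y) y.
- by move=> i j _; apply: pom_le_refl.
- by split=> [_|t]; [apply: pom_le_refl | apply; exact: 0].
- exact: pom_le_refl.
Qed.

Lemma eq_sim_on (S T : cuType) (F : set S) (f g : cuMor S T) :
  f =1 g -> sim_on F f g.
Proof.
move=> fg x' x _ _ /way_below_le xx; rewrite -!fg.
by split; apply: cu_mono.
Qed.

(** [countable_arrows] asks for equality of packed arrows, whereas uniqueness of arrows is obtained
    pointwise; this bridges the two. *)
Lemma cuMor_ext (S T : cuType) (f g : cuMor S T) : f =1 g -> f = g.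
Proof.
case: f g => [[f cf] f1 f2 f3] [[g cg] g1 g2 g3] /funext /= fg.
move: cf f1 f2 f3; rewrite fg => cf f1 f2 f3.
case: cf f1 f2 f3 => -[cf] f1 f2 f3; case: cg g1 g2 g3 => -[cg] g1 g2 g3.
rewrite (Prop_irrelevance cf cg) in f1 f2 f3 *.
by congr CuMor; apply: Prop_irrelevance.
Qed.

Lemma E_countably_based m : countably_based (E m).
Proof.
exists setT; first exact: finite_set_countable (@finite_finset (elem m) _).
move=> x; exists (fun=> x); split=> //.
- by move=> _; apply/elem_llE; apply: pom_le_refl.
- by apply: (@elem_supP _ (fun=> x) 0) => _; apply: pom_le_refl.
Qed.

Lemma E_leE m (x y : E m) : x `<= y <-> elem_rank x <= elem_rank y.
Proof. by rewrite /= elem_leE. Qed.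

Section Multiplication.
Variables m a : nat.
Hypotheses (m_gt0 : 0 < m) (a_gt0 : 0 < a).

(** The rank of oo is [m + 1], and [a * m < a * (m + 1)] for [a > 0], so this one formula also sends
    oo to oo. *)
Definition elem_mul (x : E m) : E (a * m) :=
  (elem_one (a * m) *+ (a * elem_rank x))%R.

Lemma elem_rank_mul (x : E m) :
  elem_rank (elem_mul x) = minn (a * elem_rank x) (a * m).+1.
Proof. by rewrite elem_rankMn // muln_gt0 a_gt0. Qed.

Lemma elem_mul_nmod_morphism : nmod_morphism elem_mul.
Proof.
split; first by rewrite /elem_mul muln0.
move=> x y; apply: elem_rank_inj.
rewrite [RHS]elem_rankD !elem_rank_mul [elem_rank (_ + _)%R]elem_rankD; nia.
Qed.

HB.instance Definition _ :=
  GRing.isNmodMorphism.Build (E m) (E (a * m)) elem_mul elem_mul_nmod_morphism.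

(** Truncation at [a * m + 1] can only affect the image of oo, which still lies above all the
    others. *)
Lemma elem_mul_le (x y : E m) : elem_mul x `<= elem_mul y <-> x `<= y.
Proof.
rewrite !E_leE !elem_rank_mul.
have := elem_rank_le x; have := elem_rank_le y.
by split; nia.
Qed.

Lemma elem_mul_ll (x y : E m) : x `<< y -> elem_mul x `<< elem_mul y.
Proof. by move=> /elem_llE xy; apply/elem_llE/elem_mul_le. Qed.

(** Suprema in [E m] are attained, so monotonicity suffices. *)
Lemma elem_mul_sup (u : nat -> E m) (s : E m) :
  increasing u -> is_sup u s -> is_sup (elem_mul \o u) (elem_mul s).
Proof.
move=> _ /elem_sup_max[N -> uN].
by apply: (@elem_supP _ (elem_mul \o u)) => k; apply/elem_mul_le.
Qed.

Definition elem_mulMor : cuMor (E m) (E (a * m)) :=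
  @CuMor (E m) (E (a * m)) elem_mul (fun x y => (elem_mul_le x y).2)
    elem_mul_ll elem_mul_sup.

Lemma elem_mulMor_is_mul_by : is_mul_by a elem_mulMor.
Proof.
split=> //; apply: elem_rank_inj; rewrite [LHS]elem_rank_mul /=; nia.
Qed.

Lemma elem_mulMor_embedding : order_embedding elem_mulMor.
Proof. by move=> x y /elem_mul_le. Qed.

End Multiplication.

Lemma is_mul_by_embedding_bounds m m' a (f : cuMor (E m) (E m')) :
  0 < m -> 0 < m' -> is_mul_by a f -> order_embedding f ->
  a * m <= m' < a * m.+1.
Proof.
move=> m_gt0 m'_gt0 [fS foo] fE; apply/andP; split.
  (* Otherwise the largest finite element and oo have the same image. *)
  rewrite leqNgt; apply/negP => lt_m'.
  suff /fE : f (elem_oo m) `<= f (Some ord_max) by [].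
  by apply/E_leE; rewrite foo fS elem_rankMn //=; lia.
have : f ((Some ord_max : elem m) + elem_one m)%R = f (elem_oo m).
  congr (f _); apply: elem_rank_inj; rewrite [LHS]elem_rankD /= inordK //; lia.
rewrite raddfD foo /elem_one !fS /= inordK // -mulrnDr.
move=> /(congr1 (@elem_rank _)).
by rewrite elem_rankMn //= mulnS; lia.
Qed.

Section ElementaryCategory.
Variable n : nat.
Hypothesis n_gt0 : 0 < n.

Lemma e_hom_is_mul_by m m' (f : cuMor (E m) (E m')) :
  e_hom n f -> exists2 a, a * m = m' & is_mul_by a f.
Proof.
(* Inverting [e_hom] needs variable endpoints; the transports become trivial once [E_inj] identifies
   the indices. *)
have aux (A B : cuType) (g : cuMor A B) : e_hom n g ->
    forall (eA : A = E m) (eB : B = E m'),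
    exists2 a, a * m = m' & is_mul_by a
      (eq_rect B (cuMor (E m)) (eq_rect A (fun X => cuMor X B) g _ eA) _ eB).
  case=> k s j {}g gM gE eA eB.
  have ek := E_inj eA; have es := E_inj eB; subst m m'.
  rewrite (Prop_irrelevance eA erefl) (Prop_irrelevance eB erefl) /=.
  exists (n ^ j) => //.
  have := is_mul_by_embedding_bounds _ _ gM gE.
  rewrite !expn_gt0 n_gt0 => /(_ isT isT).
  case: (ltnP 1 n) => [n_gt1|n_le1]; last first.
    have -> : n = 1 by lia.
    by rewrite !exp1n.
  rewrite mulnS -expnD leq_exp2l // => /andP[le_s lt_s].
  congr (n ^ _); apply/eqP.
  (* [n^s < n^j + n^(j+k) <= 2 n^(j+k) <= n^(j+k+1)] leaves only [s = j + k]. *)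
  rewrite eqn_leq le_s /= -ltnS -(ltn_exp2l _ _ n_gt1).
  apply: leq_trans lt_s _; rewrite expnS.
  have : n ^ j <= n ^ (j + k) by rewrite leq_exp2l // leq_addr.
  nia.
by move=> /aux/(_ erefl erefl).
Qed.

(** Cancelling [n ^ k > 0] determines the factor. The exponent [j] would not do: it is ambiguous
    when [n = 1]. *)
Lemma e_hom_unique (A B : cuType) (f g : cuMor A B) :
  e_hom n f -> e_hom n g -> f =1 g.
Proof.
move=> hf; have [oA oB] := e_hom_obj hf.
case: oA f g hf => k f g hf; case: oB f g hf => s f g.
move=> /e_hom_is_mul_by[a ea [fS foo]] /e_hom_is_mul_by[b eb [gS goo]].
have eab : a = b.
  by apply/eqP; rewrite -(@eqn_pmul2r (n ^ k)) ?expn_gt0 ?n_gt0 // ea eb.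
by case=> [x|]; [rewrite fS gS eab | rewrite foo goo].
Qed.

Lemma e_hom_exists k s : k <= s ->
  exists f : cuMor (E (n ^ k)) (E (n ^ s)), e_hom n f.
Proof.
move=> le_ks; have e : n ^ (s - k) * n ^ k = n ^ s by rewrite -expnD subnK.
have m_gt0 : 0 < n ^ k by rewrite expn_gt0 n_gt0.
have a_gt0 : 0 < n ^ (s - k) by rewrite expn_gt0 n_gt0.
have := @elem_mulMor_embedding _ _ m_gt0 a_gt0.
have := elem_mulMor_is_mul_by m_gt0 a_gt0.
(* Generalizing the morphism allows its codomain to be rewritten to [E (n ^ s)]. *)
move: (elem_mulMor m_gt0 a_gt0); rewrite e => f fM fE.
by exists f; apply: EHom fM fE.
Qed.

Lemma e_obj_countably_based (A : cuType) : e_obj n A -> countably_based A.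
Proof. by case=> k; apply: E_countably_based. Qed.

(** An arrow is determined by its endpoints, so a code for the pair of their indices suffices. *)
Lemma e_cat_countable_arrows : countable_arrows (e_cat n).
Proof.
have code (p : {A : cuType & {B : cuType & cuMor A B}}) : exists c : nat,
    e_obj n (projT1 p) -> e_obj n (projT1 (projT2 p)) ->
    exists m m', [/\ projT1 p = E m, projT1 (projT2 p) = E m' &
                     c = pickle (m, m')].
  case: p => A [B f] /=; have [[oA oB]|nAB] := pselect (e_obj n A /\ e_obj n B).
    case: oA => k in f *; case: oB => s in f *.
    by exists (pickle (n ^ k, n ^ s)) => _ _; exists (n ^ k), (n ^ s).
  (* Junk code for arrows with an endpoint outside the category. *)
  by exists 0 => oA oB; case: nAB.
exists (fun p => projT1 (cid (code p))) => A B A' B' f g hf hg /=.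
case: cid => c /=; case: cid => c' /=.
have [oA oB] := e_hom_obj hf; have [oA' oB'] := e_hom_obj hg.
move=> /(_ oA' oB')[m1 [m1' [eA' eB' ->]]] /(_ oA oB)[m2 [m2' [eA eB ->]]].
move=> /(pcan_inj pickleK)[em em'].
have {eA' em}eA : A = A' by rewrite eA eA' em.
have {eB' em'}eB : B = B' by rewrite eB eB' em'.
by subst A' B'; rewrite (cuMor_ext (e_hom_unique hf hg)).
Qed.

Lemma e_cat_JEP : JEP (e_cat n).
Proof.
move=> _ _ [k] [s]; exists (E (n ^ maxn k s)); split; first exact: EObj.
- by apply: e_hom_exists; rewrite leq_maxl.
- by apply: e_hom_exists; rewrite leq_maxr.
Qed.

(** Any cospan from joint embedding closes the square, which commutes exactly by uniqueness. *)
Lemma e_cat_NAP : NAP (e_cat n).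
Proof.
move=> A B1 B2 a1 a2 F h1 h2 _.
have [[_ o1] [_ o2]] := (e_hom_obj h1, e_hom_obj h2).
have [C [oC [b1 hb1] [b2 hb2]]] := e_cat_JEP o1 o2.
exists C, b1, b2; split=> //; apply/eq_sim_on/e_hom_unique.
- exact: e_hom_comp h1 hb1.
- exact: e_hom_comp h2 hb2.
Qed.

Lemma e_cat_SEP : SEP (e_cat n).
Proof.
exists (e_cat n); split=> //.
- exact: e_obj_countably_based.
- exact: e_cat_countable_arrows.
- by move=> A oA; exists A, (cu_id A); split=> //; apply: e_hom_id.
- move=> S A sigma F _ hsigma _; have [_ oA] := e_hom_obj hsigma.
  exists A, (cu_id A), sigma; split=> //; first exact: e_hom_id.
  exact: eq_sim_on.
Qed.

End ElementaryCategory.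

Theorem proposition4p17 (n : nat) (hn : 1 <= n) : fraisse_category (e_cat n).
Proof.
by split; [apply: e_cat_JEP | apply: e_cat_NAP | apply: e_cat_SEP].
Qed.
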